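(* Consider the complex 3-dimensional Novikov algebras $B_1$, $B_2$, $B_3$, $B_4(\alpha)$ $(\alpha\in\mathbb{C})$, $B_5(\beta)$ $(\beta\in\mathbb{C})$ and $A_1,\dots,A_{12}$ given by the products listed in the context. For $A$ in the first list (type $B$) and $1\le j\le 12$, the algebra $A_j$ lies in $\partial O(A)$ if and only if $A_j$ is one of the algebras given for $A$ below: \begin{itemize} \item $A=B_1$: $A_1, A_5, A_{11}$; \item $A=B_2$: $A_1, A_5, A_9, A_{10}, A_{11}, A_{12}$; \item $A=B_3$: $A_1, A_5$; \item $A=B_4(\alpha)$, $\alpha\in\mathbb{C}$: $A_1, A_5$; \item $A=B_5(\beta)$ with $\beta\neq\tfrac12$: $A_1, A_5$; \item $A=B_5(\tfrac12)$: $A_1$. \end{itemize}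
   Context: A Novikov algebra over $\mathbb{C}$ is a complex vector space with a bilinear product satisfying $(x\cdot y)\cdot z-x\cdot(y\cdot z)=(y\cdot x)\cdot z-y\cdot(x\cdot z)$ and $(x\cdot y)\cdot z=(x\cdot z)\cdot y$ for all $x,y,z$. Fix a 3-dimensional complex vector space $V$ with basis $(e_1,e_2,e_3)$. The set of Novikov products on $V$, identified with their structure constants in $\mathbb{C}^{27}$, is an affine algebraic set, on which $GL_3(\mathbb{C})$ acts by $(g\circ\mu)(x,y)=g(\mu(g^{-1}x,g^{-1}y))$. For a 3-dimensional Novikov algebra $A$, $O(A)$ is the orbit of a structure representing $A$, $\overline{O(A)}$ its Zariski closure, and $\partial O(A)=\overline{O(A)}\setminus O(A)$; ''$B$ lies in $\partial O(A)$'' means that a structure representing $B$ lies in $\partial O(A)$. The algebras (basis $e_1,e_2,e_3$; products of basis vectors not listed are zero): $B_1$: $e_1e_1=e_1$, $e_1e_2=e_2+e_3$, $e_1e_3=e_3$, $e_2e_1=e_2$, $e_3e_1=e_3$. $B_2$: $e_1e_1=e_1$, $e_1e_2=e_2+e_3$, $e_1e_3=e_3$, $e_2e_1=e_2$, $e_2e_2=e_3$, $e_3e_1=e_3$. $B_3$: $e_1e_2=\frac12e_3$, $e_2e_1=-\frac12e_3$, $e_2e_2=e_3$. $B_4(\alpha)$: $e_1e_2=\alpha e_3$, $e_2e_1=(\alpha-1)e_3$, $e_2e_2=e_1$. $B_5(\beta)$: $e_1e_2=\beta e_3$, $e_2e_1=(\beta-1)e_3$. $A_1$: all products zero. $A_2$: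 $e_3e_3=e_3$. $A_3$: $e_2e_2=e_2$, $e_3e_3=e_3$. $A_4$: $e_1e_1=e_1$, $e_2e_2=e_2$, $e_3e_3=e_3$. $A_5$: $e_2e_2=e_1$. $A_6$: $e_2e_2=e_1$, $e_3e_3=e_3$. $A_7$: $e_1e_2=e_1$, $e_2e_1=e_1$, $e_2e_2=e_2$. $A_8$: $e_1e_2=e_1$, $e_2e_1=e_1$, $e_2e_2=e_2$, $e_3e_3=e_3$. $A_9$: $e_2e_3=e_1$, $e_3e_2=e_1$. $A_{10}$: $e_2e_3=e_1$, $e_3e_2=e_1$, $e_3e_3=e_2$. $A_{11}$: $e_1e_3=e_1$, $e_2e_3=e_2$, $e_3e_1=e_1$, $e_3e_2=e_2$, $e_3e_3=e_3$. $A_{12}$: $e_1e_3=e_1$, $e_2e_2=e_1$, $e_2e_3=e_2$, $e_3e_1=e_1$, $e_3e_2=e_2$, $e_3e_3=e_3$. *)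

(* Defs.v *)
From HB Require Import structures.
From mathcomp Require Import all_boot all_order all_algebra.
From mathcomp Require Import classical_sets reals complex mpoly.

Set Implicit Arguments.
Unset Strict Implicit.
Unset Printing Implicit Defensive.

Import GRing.Theory.
Local Open Scope ring_scope.
Local Open Scope classical_set_scope.

Section NovikovVariety.
Variable K : fieldType.

Local Notation V := 'cV[K]_3.
Local Notation triple := ('I_3 * 'I_3 * 'I_3)%type.

(* c (i, j, k) is the coefficient of e_k in e_i e_j; indices are 0-based. *)
Definition structure := {ffun triple -> K}.

Definition product (c : structure) (x y : V) : V :=
  \col_k \sum_i \sum_j c (i, j, k) * x i 0 * y j 0.

Definition structure_of (mu : V -> V -> V) : structure :=
  [ffun t => mu (delta_mx t.1.1 0) (delta_mx t.1.2 0) t.2 0].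

Definition novikov (mu : V -> V -> V) : Prop :=
  (forall x y z, mu (mu x y) z - mu x (mu y z) = mu (mu y x) z - mu y (mu x z))
  /\ (forall x y z, mu (mu x y) z = mu (mu x z) y).

Definition novikov_variety : set structure := [set c | novikov (product c)].

Definition transport (g : 'M[K]_3) (mu : V -> V -> V) (x y : V) : V :=
  g *m mu (invmx g *m x) (invmx g *m y).

Definition orbit (c : structure) : set structure :=
  [set structure_of (transport g (product c)) | g in [set g | g \in unitmx]].

Definition zero_locus (I : set {mpoly K[#|{: triple}|]}) : set structure :=
  [set c : structure | forall p, I p -> p.@[fun i => c (enum_val i)] = 0].

Definition zariski_closed (Z : set structure) : Prop :=
  exists I, Z = zero_locus I.

(* Closure inside the Novikov variety, i.e. for the topology induced by the
   Zariski topology of the 27-dimensional affine space. *)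
Definition orbit_closure (c : structure) : set structure :=
  novikov_variety `&` smallest zariski_closed (orbit c).

Definition boundary (c : structure) : set structure :=
  orbit_closure c `\` orbit c.

(* 1-based: e 1, e 2, e 3 are the basis vectors. *)
Definition e (n : nat) : V := \col_k (k.+1 == n)%:R.

(* An entry (i, j, v) with i, j in {1, 2, 3} means e_i e_j = v; the products
   of basis vectors that are not listed are zero. *)
Definition table (s : seq (nat * nat * V)) : structure :=
  [ffun t : triple =>
    (\sum_(q <- s | (q.1.1 == t.1.1.+1) && (q.1.2 == t.1.2.+1)) q.2) t.2 0].
Local Notation rule i j v := (i%N, j%N, v).

Definition algB1 := table
  [:: rule 1 1 (e 1); rule 1 2 (e 2 + e 3); rule 1 3 (e 3); rule 2 1 (e 2);
      rule 3 1 (e 3)].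
Definition algB2 := table
  [:: rule 1 1 (e 1); rule 1 2 (e 2 + e 3); rule 1 3 (e 3); rule 2 1 (e 2);
      rule 2 2 (e 3); rule 3 1 (e 3)].
Definition algB3 := table
  [:: rule 1 2 (2^-1 *: e 3); rule 2 1 (- 2^-1 *: e 3); rule 2 2 (e 3)].
Definition algB4 (alpha : K) := table
  [:: rule 1 2 (alpha *: e 3); rule 2 1 ((alpha - 1) *: e 3); rule 2 2 (e 1)].
Definition algB5 (beta : K) := table
  [:: rule 1 2 (beta *: e 3); rule 2 1 ((beta - 1) *: e 3)].

(* Meaningful for 1 <= j <= 12 only. *)
Definition algA (j : nat) : structure :=
  table match j with
  | 2%N => [:: rule 3 3 (e 3)]
  | 3%N => [:: rule 2 2 (e 2); rule 3 3 (e 3)]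
  | 4%N => [:: rule 1 1 (e 1); rule 2 2 (e 2); rule 3 3 (e 3)]
  | 5%N => [:: rule 2 2 (e 1)]
  | 6%N => [:: rule 2 2 (e 1); rule 3 3 (e 3)]
  | 7%N => [:: rule 1 2 (e 1); rule 2 1 (e 1); rule 2 2 (e 2)]
  | 8%N => [:: rule 1 2 (e 1); rule 2 1 (e 1); rule 2 2 (e 2); rule 3 3 (e 3)]
  | 9%N => [:: rule 2 3 (e 1); rule 3 2 (e 1)]
  | 10%N => [:: rule 2 3 (e 1); rule 3 2 (e 1); rule 3 3 (e 2)]
  | 11%N =>
      [:: rule 1 3 (e 1); rule 2 3 (e 2); rule 3 1 (e 1); rule 3 2 (e 2);
          rule 3 3 (e 3)]
  | 12%N =>
      [:: rule 1 3 (e 1); rule 2 2 (e 1); rule 2 3 (e 2); rule 3 1 (e 1);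
          rule 3 2 (e 2); rule 3 3 (e 3)]
  | _ => [::]
  end.

End NovikovVariety.

(* Main.v *)
Require Import Defs.
From HB Require Import structures.
From mathcomp Require Import all_boot all_order all_algebra.
From mathcomp Require Import classical_sets reals complex mpoly.
From mathcomp Require Import ring.

(** Whether [A_j] lies in the closure of an orbit [O(B)] is decided by a few
polynomial conditions on one side and by explicit curves on the other. That it
then lies in the boundary is automatic: every [A_j] is commutative and no [B]
is ([boundary_algA]).

Exclusions. A polynomial function of the structure constants that vanishes on
an orbit vanishes on its closure ([closure_vanish]). Write [L_x] for the left
multiplication by [x]. Four isomorphism-invariant conditions are enough.
- [tr L_x = 0] holds in the nilpotent algebras [B_3], [B_4(alpha)] and
  [B_5(beta)].
- [3 tr(L_x^2) = (tr L_x)^2] holds in [B_1] and [B_2], where every [L_x] is a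
  scalar plus a nilpotent map. If [x] acts as a projection of rank [r], it says
  [3 r = r^2]; this excludes every [A_j] in which some idempotent acts as a
  projection of rank 1 or 2.
- [x x = 0] holds in [B_5(1/2)] and leaves only [A_1].
- The main point is the separation of [B_1], [B_3], [B_4(alpha)] and
  [B_5(beta)] from [A_9], [A_10] and [A_12]. The symmetric part of the product
  of [B_4(alpha)] for [alpha != 1/2] is isomorphic to [A_10], so no condition
  on the symmetric part alone can exclude [A_10] or its limit [A_9]: the
  commutator has to enter. With
  [N(x, y) = 3 (x y + y x) - 2 tr(L_x) y - 2 tr(L_y) x], these four algebras
  satisfy, in the symmetric square of [V],
  [N(x, x) N(y, y) - N(x, y)^2 + delta [x, y]^2 = 0]
  for a suitable constant [delta]. For a linear form [phi] this compares the
  Gram determinants of the quadratic form [phi(N(x, x))] with the squares of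
  the alternating form [phi([x, y])]. In a commutative algebra the second ones
  vanish, so all the forms [phi(N(x, x))] would have rank at most 1, which is
  false in [A_9], [A_10] and [A_12] ([disc_algA]).

Degenerations. If the structures [d0 + t d1 + t^2 d2] lie in the orbit of [c]
for all [t != 0], then [d0] lies in its closure, because a polynomial in [t]
that vanishes for [t != 0] vanishes at [0] ([deformation_closure]). The curve
is given by a moving basis [f1(t), f2(t), f3(t)] in which the multiplication
table of [c] is the deformed table ([degeneration]). *)

Set Implicit Arguments.
Unset Strict Implicit.
Unset Printing Implicit Defensive.

Import Order.TTheory GRing.Theory Num.Theory.
Local Open Scope ring_scope.
Local Open Scope classical_set_scope.

Local Notation rule i j v := (i%N, j%N, v).

(** * Structures as bilinear products *)

Section Structures.
Variable K : fieldType.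
Local Notation V := 'cV[K]_3.
Implicit Types (c d : structure K) (x y z u v : V).

Definition o1 : 'I_3 := @Ordinal 3 0 isT.
Definition o2 : 'I_3 := @Ordinal 3 1 isT.
Definition o3 : 'I_3 := @Ordinal 3 2 isT.

Lemma ord3_ind (P : 'I_3 -> Prop) : P o1 -> P o2 -> P o3 -> forall k, P k.
Proof.
move=> P1 P2 P3 [[|[|[|//]]] lt_k3]; set k := Ordinal _.
- by rewrite (_ : k = o1) //; apply: val_inj.
- by rewrite (_ : k = o2) //; apply: val_inj.
- by rewrite (_ : k = o3) //; apply: val_inj.
Qed.

Lemma sum_ord3 (W : nmodType) (F : 'I_3 -> W) :
  \sum_i F i = F o1 + F o2 + F o3.
Proof.
rewrite 3!big_ord_recr big_ord0 /= add0r.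
by congr (F _ + F _ + F _); apply: val_inj.
Qed.

(** The coordinates are numbered from 1, as in the multiplication tables. *)
Definition ecoord (n : nat) x : K := \sum_i (e K n i 0) * x i 0.

Lemma product_table s x y :
  product (table s) x y
  = \sum_(q <- s) (ecoord q.1.1 x * ecoord q.1.2 y) *: q.2.
Proof.
apply/colP => k; rewrite mxE summxE.
have entry i j : table s (i, j, k) * x i 0 * y j 0
    = \sum_(q <- s)
        (e K q.1.1 i 0 * x i 0) * (e K q.1.2 j 0 * y j 0) * q.2 k 0.
  rewrite ffunE /= summxE big_mkcond /= !mulr_suml.
  apply: eq_bigr => q _; rewrite !mxE [i.+1 == _]eq_sym [j.+1 == _]eq_sym.
  by do 2!case: eqP => _; rewrite /= ?(mul0r, mulr0, mul1r) // -mulrA mulrC.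
under eq_bigr => i _ do under eq_bigr => j _ do rewrite entry.
under eq_bigr => i _ do rewrite exchange_big /=.
rewrite exchange_big /=; apply: eq_bigr => q _; rewrite mxE !mulr_suml.
apply: eq_bigr => i _; rewrite mulr_sumr mulr_suml.
by apply: eq_bigr => j _.
Qed.

Definition deformation (c0 c1 c2 : structure K) t : structure K :=
  [ffun k => c0 k + t * c1 k + t ^+ 2 * c2 k].

Lemma product_deformation c0 c1 c2 t x y :
  product (deformation c0 c1 c2 t) x y
  = product c0 x y + t *: product c1 x y + t ^+ 2 *: product c2 x y.
Proof.
apply/colP => k; rewrite !mxE !mulr_sumr -!big_split; apply: eq_bigr => i _ /=.
rewrite !mulr_sumr -!big_split; apply: eq_bigr => j _ /=.
by rewrite ffunE !mulrDl !mulrA.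
Qed.

Definition lmul c x : 'M[K]_3 := \matrix_(k, j) \sum_i c (i, j, k) * x i 0.

Lemma mul_lmul c x y : lmul c x *m y = product c x y.
Proof.
apply/colP => k; rewrite !mxE exchange_big /=; apply: eq_bigr => j _.
by rewrite mxE mulr_suml.
Qed.

Lemma lmul_inj c x (M : 'M[K]_3) :
  (forall y, M *m y = product c x y) -> M = lmul c x.
Proof.
move=> eqM; apply/matrixP => i j; apply/esym.
have := eqM (delta_mx j 0); rewrite -mul_lmul -!colE.
by move/(congr1 (fun v : V => v i 0)); rewrite !mxE.
Qed.

Lemma product_delta c i j k :
  product c (delta_mx i 0) (delta_mx j 0) k 0 = c (i, j, k).
Proof.
rewrite -mul_lmul -colE !mxE (bigD1 i) //= big1 ?addr0 => [|i' /negPf i'i].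
  by rewrite !mxE !eqxx mulr1.
by rewrite !mxE i'i mulr0.
Qed.

Lemma product_expand c x y :
  product c x y
  = \sum_i \sum_j (x i 0 * y j 0) *: product c (delta_mx i 0) (delta_mx j 0).
Proof.
apply/colP => k; rewrite mxE summxE; apply: eq_bigr => i _.
rewrite summxE; apply: eq_bigr => j _; rewrite mxE product_delta.
by rewrite -mulrA mulrC.
Qed.

Lemma productDl c x x' y :
  product c (x + x') y = product c x y + product c x' y.
Proof.
apply/colP => k; rewrite !mxE -big_split; apply: eq_bigr => i _ /=.
by rewrite -big_split; apply: eq_bigr => j _; rewrite mxE mulrDr mulrDl.
Qed.

Lemma productZl c a x y : product c (a *: x) y = a *: product c x y.
Proof.
apply/colP => k; rewrite !mxE mulr_sumr; apply: eq_bigr => i _ /=.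
by rewrite mulr_sumr; apply: eq_bigr => j _; rewrite mxE mulrCA !mulrA.
Qed.

Lemma productZr c a x y : product c x (a *: y) = a *: product c x y.
Proof. by rewrite -!mul_lmul scalemxAr. Qed.

Lemma product_suml c I (r : seq I) (F : I -> V) y :
  product c (\sum_(i <- r) F i) y = \sum_(i <- r) product c (F i) y.
Proof.
apply: (big_morph (fun x => product c x y) (fun x x' => productDl c x x' y)).
by rewrite -[0 in LHS](scale0r (0 : V)) productZl scale0r.
Qed.

Lemma product_sumr c I (r : seq I) (F : I -> V) x :
  product c x (\sum_(i <- r) F i) = \sum_(i <- r) product c x (F i).
Proof. by rewrite -mul_lmul mulmx_sumr; under eq_bigr do rewrite mul_lmul. Qed.

Lemma col_delta x : x = \sum_i x i 0 *: delta_mx i 0.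
Proof.
rewrite {1}(matrix_sum_delta x); apply: eq_bigr => i _.
by rewrite big_ord1.
Qed.

(** Being in an orbit means being isomorphic; [P] maps the algebra [d] to [c],
so its columns are a basis of [c] with the multiplication table [d]. *)
Lemma orbitP c d :
  Defs.orbit c d <->
  exists2 P, P \in unitmx
    & forall x y, P *m product d x y = product c (P *m x) (P *m y).
Proof.
split=> [[g gU <-] | [P PU iso]].
  exists (invmx g); first by rewrite unitmx_inv.
  move=> x y; set d' := structure_of _.
  have basis i j : product d' (delta_mx i 0) (delta_mx j 0)
      = transport g (product c) (delta_mx i 0) (delta_mx j 0).
    by apply/colP => k; rewrite product_delta /d' ffunE.
  rewrite product_expand mulmx_sumr [in RHS](col_delta x) mulmx_sumr.
  rewrite product_suml.
  apply: eq_bigr => i _; rewrite [in RHS](col_delta y) !mulmx_sumr product_sumr.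
  apply: eq_bigr => j _; rewrite basis /transport -!scalemxAr mulKmx //.
  by rewrite productZl productZr scalerA.
exists (invmx P); first by rewrite /= unitmx_inv.
apply/ffunP => -[[i j] k]; rewrite ffunE /= /transport invmxK -iso mulKmx //.
by rewrite product_delta.
Qed.

End Structures.

(** * Vectors given by their coordinates *)

Section Coordinates.
Variable K : fieldType.
Local Notation V := 'cV[K]_3.
Implicit Types (x : V) (M : 'M[K]_3).

Definition vec (a b c : K) : V := \col_k nth 0 [:: a; b; c] k.

Lemma vec_eta x : exists a b c, x = vec a b c.
Proof.
exists (x o1 0), (x o2 0), (x o3 0).
by apply/colP => k; rewrite mxE; elim/ord3_ind: k.
Qed.

Lemma e1E : e K 1 = vec 1 0 0.
Proof. by apply/colP => k; rewrite !mxE; elim/ord3_ind: k. Qed.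
Lemma e2E : e K 2 = vec 0 1 0.
Proof. by apply/colP => k; rewrite !mxE; elim/ord3_ind: k. Qed.
Lemma e3E : e K 3 = vec 0 0 1.
Proof. by apply/colP => k; rewrite !mxE; elim/ord3_ind: k. Qed.

Lemma vecD a b c a' b' c' :
  vec a b c + vec a' b' c' = vec (a + a') (b + b') (c + c').
Proof. by apply/colP => k; rewrite !mxE; elim/ord3_ind: k. Qed.

Lemma vecZ r a b c : r *: vec a b c = vec (r * a) (r * b) (r * c).
Proof. by apply/colP => k; rewrite !mxE; elim/ord3_ind: k. Qed.

Lemma vecN a b c : - vec a b c = vec (- a) (- b) (- c).
Proof. by apply/colP => k; rewrite !mxE; elim/ord3_ind: k. Qed.

Lemma vec0 : 0 = vec 0 0 0.
Proof. by apply/colP => k; rewrite !mxE; elim/ord3_ind: k. Qed.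

Lemma ecoord_vec n a b c :
  ecoord n (vec a b c)
  = match n with 1%N => a | 2%N => b | 3%N => c | _ => 0 end.
Proof.
rewrite /ecoord sum_ord3 !mxE /=.
by case: n => [|[|[|[|n]]]]; rewrite /= !(mul0r, mul1r, add0r, addr0).
Qed.

Lemma vec_inj a b c a' b' c' :
  vec a b c = vec a' b' c' -> [/\ a = a', b = b' & c = c'].
Proof.
by move=> /colP eqv; split; [move: (eqv o1) | move: (eqv o2) | move: (eqv o3)];
  rewrite !mxE.
Qed.

Lemma eq_vec a b c a' b' c' :
  a = a' -> b = b' -> c = c' -> vec a b c = vec a' b' c'.
Proof. by move=> -> -> ->. Qed.

Definition frame (f1 f2 f3 : V) : 'M[K]_3 :=
  \matrix_(k, j) (nth 0 [:: f1; f2; f3] j) k 0.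

Lemma mul_frame f1 f2 f3 a b c :
  frame f1 f2 f3 *m vec a b c = a *: f1 + b *: f2 + c *: f3.
Proof. by apply/colP => k; rewrite mxE sum_ord3 !mxE /=; ring. Qed.

Lemma det_frame a1 b1 c1 a2 b2 c2 a3 b3 c3 :
  \det (frame (vec a1 b1 c1) (vec a2 b2 c2) (vec a3 b3 c3))
  = a1 * (b2 * c3 - b3 * c2) - a2 * (b1 * c3 - b3 * c1)
    + a3 * (b1 * c2 - b2 * c1).
Proof.
rewrite (expand_det_row _ o1) sum_ord3 /cofactor.
rewrite !(expand_det_row _ (0 : 'I_2)) !big_ord_recl !big_ord0 /cofactor.
rewrite !det_mx11.
rewrite !mxE /=.
by rewrite /bump /=; ring.
Qed.

Lemma trace_ecoord M :
  \tr M
  = ecoord 1 (M *m e K 1) + ecoord 2 (M *m e K 2) + ecoord 3 (M *m e K 3).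
Proof.
rewrite /mxtrace sum_ord3; congr (_ + _ + _);
  rewrite /ecoord sum_ord3 !mxE !sum_ord3 !mxE /=;
  by rewrite !(mul1r, mul0r, mulr1, mulr0, addr0, add0r).
Qed.

End Coordinates.

Ltac coordinates x :=
  let a := fresh x in let b := fresh x in let c := fresh x in
  have [a [b [c ->]]] := vec_eta x.

(** Puts an expression in vectors into the form [vec _ _ _]. *)
Ltac vectors :=
  rewrite ?(e1E, e2E, e3E, vec0, mul_frame, vecZ, vecD, vecN, ecoord_vec) /=.

Ltac tables := rewrite ?product_table ?(big_cons, big_nil) /=; vectors.

(** * The multiplication laws of the algebras *)

Section Laws.
Variable K : fieldType.
Variables (x1 x2 x3 y1 y2 y3 alpha : K).
Local Notation law c := (product c (vec x1 x2 x3) (vec y1 y2 y3)).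

Local Ltac law := rewrite /algA; tables; apply: eq_vec; ring.

Lemma algB1_law :
  law (algB1 K)
  = vec (x1 * y1) (x1 * y2 + x2 * y1) (x1 * y2 + x1 * y3 + x3 * y1).
Proof. law. Qed.

Lemma algB2_law :
  law (algB2 K)
  = vec (x1 * y1) (x1 * y2 + x2 * y1) (x1 * y2 + x1 * y3 + x3 * y1 + x2 * y2).
Proof. law. Qed.

Lemma algB3_law :
  law (algB3 K) = vec 0 0 (2^-1 * (x1 * y2 - x2 * y1) + x2 * y2).
Proof. law. Qed.

Lemma algB4_law :
  law (algB4 alpha)
  = vec (x2 * y2) 0 (alpha * (x1 * y2) + (alpha - 1) * (x2 * y1)).
Proof. law. Qed.

Lemma algB5_law :
  law (algB5 alpha) = vec 0 0 (alpha * (x1 * y2) + (alpha - 1) * (x2 * y1)).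
Proof. law. Qed.

Lemma algA1_law : law (algA K 1) = vec 0 0 0.
Proof. law. Qed.

Lemma algA2_law : law (algA K 2) = vec 0 0 (x3 * y3).
Proof. law. Qed.

Lemma algA3_law : law (algA K 3) = vec 0 (x2 * y2) (x3 * y3).
Proof. law. Qed.

Lemma algA4_law : law (algA K 4) = vec (x1 * y1) (x2 * y2) (x3 * y3).
Proof. law. Qed.

Lemma algA5_law : law (algA K 5) = vec (x2 * y2) 0 0.
Proof. law. Qed.

Lemma algA6_law : law (algA K 6) = vec (x2 * y2) 0 (x3 * y3).
Proof. law. Qed.

Lemma algA7_law : law (algA K 7) = vec (x1 * y2 + x2 * y1) (x2 * y2) 0.
Proof. law. Qed.

Lemma algA8_law : law (algA K 8) = vec (x1 * y2 + x2 * y1) (x2 * y2) (x3 * y3).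
Proof. law. Qed.

Lemma algA9_law : law (algA K 9) = vec (x2 * y3 + x3 * y2) 0 0.
Proof. law. Qed.

Lemma algA10_law : law (algA K 10) = vec (x2 * y3 + x3 * y2) (x3 * y3) 0.
Proof. law. Qed.

Lemma algA11_law :
  law (algA K 11) = vec (x1 * y3 + x3 * y1) (x2 * y3 + x3 * y2) (x3 * y3).
Proof. law. Qed.

Lemma algA12_law :
  law (algA K 12)
  = vec (x1 * y3 + x2 * y2 + x3 * y1) (x2 * y3 + x3 * y2) (x3 * y3).
Proof. law. Qed.

End Laws.

Definition lawsB := (algB1_law, algB2_law, algB3_law, algB4_law, algB5_law).
Definition lawsA :=
  (algA1_law, algA2_law, algA3_law, algA4_law, algA5_law, algA6_law,
   algA7_law, algA8_law, algA9_law, algA10_law, algA11_law, algA12_law).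

Lemma algA_novikov (K : fieldType) j : j \in [:: 1; 5; 9; 10; 11; 12]%N ->
  novikov (product (algA K j)).
Proof.
rewrite !inE => hj; split=> x y z; coordinates x; coordinates y; coordinates z.
  by case/or4P: hj => [||| /or3P[]] /eqP ->;
    rewrite !lawsA !vecN !vecD; apply: eq_vec; ring.
by case/or4P: hj => [||| /or3P[]] /eqP ->; rewrite !lawsA; apply: eq_vec; ring.
Qed.

Lemma algA_commutative (K : fieldType) j (x y : 'cV[K]_3) : (j <= 12)%N ->
  product (algA K j) x y = product (algA K j) y x.
Proof.
move=> j12; coordinates x; coordinates y.
(* The index 0 is covered by the law of [A_1]: both tables are empty. *)
by do 13?[case: j j12 => [|j] j12] => //; rewrite !lawsA; apply: eq_vec; ring.
Qed.

(** * Polynomial functions and orbit closures *)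

Section Closure.
Variable K : numFieldType.
Local Notation V := 'cV[K]_3.
Local Notation triple := ('I_3 * 'I_3 * 'I_3)%type.
Local Notation evalat p c := (p.@[fun i => (c : structure K) (enum_val i)]).
Implicit Types (c d : structure K) (x y : V) (f g : structure K -> K).

Definition polynomial_in f :=
  exists p : {mpoly K[#|{: triple}|]}, forall c, evalat p c = f c.

Lemma polynomial_entry k : polynomial_in (fun c => c k).
Proof. by exists 'X_(enum_rank k) => c; rewrite mevalXU enum_rankK. Qed.

Lemma polynomial_const a : polynomial_in (fun=> a).
Proof. by exists a%:MP => c; rewrite mevalC. Qed.

Lemma polynomialD f g : polynomial_in f -> polynomial_in g ->
  polynomial_in (fun c => f c + g c).
Proof. by move=> [p fE] [q gE]; exists (p + q) => c; rewrite mevalD fE gE. Qed.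

Lemma polynomialM f g : polynomial_in f -> polynomial_in g ->
  polynomial_in (fun c => f c * g c).
Proof. by move=> [p fE] [q gE]; exists (p * q) => c; rewrite mevalM fE gE. Qed.

Lemma polynomialN f : polynomial_in f -> polynomial_in (fun c => - f c).
Proof. by move=> [p fE]; exists (- p) => c; rewrite mevalN fE. Qed.

Lemma polynomial_sum (I : finType) (F : I -> structure K -> K) :
  (forall i, polynomial_in (F i)) -> polynomial_in (fun c => \sum_i F i c).
Proof.
move=> Fpoly; elim: (index_enum I) => [|i r [p pE]].
  by exists 0 => c; rewrite big_nil meval0.
have [q qE] := Fpoly i; exists (q + p) => c.
by rewrite big_cons mevalD qE pE.
Qed.

Lemma polynomial_ext f g : f =1 g -> polynomial_in f -> polynomial_in g.
Proof. by move=> fg [p pE]; exists p => c; rewrite pE. Qed.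

Lemma polynomial_lmul x k j : polynomial_in (fun c => lmul c x k j).
Proof.
apply: (@polynomial_ext (fun c => \sum_i c (i, j, k) * x i 0)) => [c|].
  by rewrite mxE.
apply: polynomial_sum => i.
by apply: polynomialM; [exact: polynomial_entry | exact: polynomial_const].
Qed.

Lemma polynomial_product x y k : polynomial_in (fun c => product c x y k 0).
Proof.
apply: (@polynomial_ext (fun c => \sum_j lmul c x k j * y j 0)) => [c|].
  by rewrite -mul_lmul [RHS]mxE.
apply: polynomial_sum => j.
by apply: polynomialM; [exact: polynomial_lmul | exact: polynomial_const].
Qed.

Lemma polynomial_trace x : polynomial_in (fun c => \tr (lmul c x)).
Proof. by apply: polynomial_sum => i; exact: polynomial_lmul. Qed.

Lemma closure_vanish f c d : polynomial_in f ->
  (forall c', Defs.orbit c c' -> f c' = 0) -> orbit_closure c d -> f d = 0.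
Proof.
move=> [p pE] vanish [_ cl_d].
have := cl_d (zero_locus [set p]); rewrite /zero_locus /= -pE; apply=> //.
by split=> [|c' oc' q /= ->]; [exists [set p] | rewrite pE vanish].
Qed.

Lemma poly_eq0_off0 (q : {poly K}) : (forall t, t != 0 -> q.[t] = 0) -> q = 0.
Proof.
move=> qt0; apply/eqP; case: (eqVneq q 0) => // q_neq0.
(* A nonzero [q] would have more roots 1, ..., [size q] than its degree. *)
have := @max_poly_roots _ q [seq i.+1%:R | i <- iota 0 (size q)] q_neq0.
rewrite size_map size_iota ltnn => -> //.
  by apply/allP => _ /mapP[i _ ->]; rewrite rootE qt0 ?pnatr_eq0.
by rewrite map_inj_uniq ?iota_uniq // => i j /eqP; rewrite eqr_nat => /eqP[].
Qed.

(** A polynomial equation of the closure, evaluated along the curve, is a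
polynomial in [t] that vanishes for [t != 0], hence also at [t = 0]. *)
Lemma deformation_closure c d0 d1 d2 : novikov (product d0) ->
  (forall t, t != 0 -> Defs.orbit c (deformation d0 d1 d2 t)) ->
  orbit_closure c d0.
Proof.
move=> nov_d0 curve; split=> // Z [[I ->] orbitZ] p Ip.
pose h (i : 'I_#|{: triple}|) : {poly K} :=
  (d0 (enum_val i))%:P + 'X * (d1 (enum_val i))%:P
   + 'X ^+ 2 * (d2 (enum_val i))%:P.
pose q := mmap polyC h p.
have qE t : q.[t] = evalat p (deformation d0 d1 d2 t).
  rewrite mevalE /q /mmap horner_sum; apply: eq_bigr => m _.
  rewrite hornerM hornerC horner_prod; congr (_ * _); apply: eq_bigr => i _.
  by rewrite horner_exp /h ffunE !hornerE.
have q0 : q = 0.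
  apply: poly_eq0_off0 => t t_neq0; rewrite qE.
  exact: (orbitZ _ (curve t t_neq0)).
have := qE 0; rewrite q0 horner0 => /esym <-; apply: meval_eq => i.
by rewrite ffunE expr0n !mul0r !addr0.
Qed.

Lemma degeneration c d0 d1 d2 (f1 f2 f3 : K -> V) : novikov (product d0) ->
  (forall t, t != 0 -> \det (frame (f1 t) (f2 t) (f3 t)) != 0) ->
  (forall t x y, t != 0 ->
     frame (f1 t) (f2 t) (f3 t) *m product (deformation d0 d1 d2 t) x y
     = product c (frame (f1 t) (f2 t) (f3 t) *m x)
                 (frame (f1 t) (f2 t) (f3 t) *m y)) ->
  orbit_closure c d0.
Proof.
move=> nov_d0 det_neq0 iso; apply: (deformation_closure nov_d0) => t t_neq0.
apply/orbitP; exists (frame (f1 t) (f2 t) (f3 t)) => [|x y]; last exact: iso.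
by rewrite unitmxE unitfE det_neq0.
Qed.

End Closure.

(** * Invariant closed conditions *)

Section ClosedConditions.
Variable K : numFieldType.
Local Notation V := 'cV[K]_3.
Implicit Types (c d : structure K) (x y u v : V).

(** The product [u v] in the symmetric square of [V], up to a factor 2. *)
Definition symprod u v : 'M[K]_3 := u *m v^T + v *m u^T.

(** The form [N]: six times the symmetric part of the product, corrected by
traces. The correction turns the product of [A_11], a limit of [B_1] that has
to satisfy every closed condition of [B_1], into [- 6 x3 y3 e3], a form of rank
one. *)
Definition jordan_part c x y : V :=
  3 *: (product c x y + product c y x)
  - 2 *: (\tr (lmul c x) *: y + \tr (lmul c y) *: x).

Definition commutator c x y : V := product c x y - product c y x.

(** For a linear form [phi], applying [phi] to both factors gives twice the Gram
determinant of [phi \o jordan_part c] at [x, y] plus [2 delta phi([x, y])^2]. *)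
Definition discriminant delta c x y : 'M[K]_3 :=
  symprod (jordan_part c x x) (jordan_part c y y)
  - symprod (jordan_part c x y) (jordan_part c x y)
  + delta *: symprod (commutator c x y) (commutator c x y).

Lemma symprodE u v k l : symprod u v k l = u k 0 * v l 0 + v k 0 * u l 0.
Proof. by rewrite !mxE !big_ord1 !mxE. Qed.

Lemma symprod_congr (P : 'M[K]_3) u v :
  symprod (P *m u) (P *m v) = P *m symprod u v *m P^T.
Proof. by rewrite /symprod !trmx_mul mulmxDr mulmxDl !mulmxA. Qed.

Section Isomorphism.
Variables (c d : structure K) (P : 'M[K]_3).
Hypothesis PU : P \in unitmx.
Hypothesis iso : forall x y, P *m product d x y = product c (P *m x) (P *m y).

Lemma iso_lmul x : lmul d x = invmx P *m lmul c (P *m x) *m P.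
Proof.
apply/esym/lmul_inj => y.
by rewrite -!mulmxA mul_lmul -iso mulKmx.
Qed.

Lemma iso_trace x : \tr (lmul d x) = \tr (lmul c (P *m x)).
Proof. by rewrite iso_lmul mxtrace_mulC mulmxA mulmxV // mul1mx. Qed.

Lemma iso_trace_square x :
  \tr (lmul d x *m lmul d x) = \tr (lmul c (P *m x) *m lmul c (P *m x)).
Proof.
by rewrite iso_lmul !mulmxA mulmxK // mxtrace_mulC !mulmxA mulmxV // mul1mx.
Qed.

Lemma iso_commutator x y :
  commutator c (P *m x) (P *m y) = P *m commutator d x y.
Proof. by rewrite /commutator -!iso mulmxBr. Qed.

Lemma iso_jordan_part x y :
  jordan_part c (P *m x) (P *m y) = P *m jordan_part d x y.
Proof.
rewrite /jordan_part -!iso -!iso_trace mulmxBr -!scalemxAr !mulmxDr.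
by rewrite -!scalemxAr.
Qed.

Lemma iso_discriminant delta x y :
  discriminant delta c (P *m x) (P *m y) = P *m discriminant delta d x y *m P^T.
Proof.
rewrite /discriminant !iso_jordan_part !iso_commutator !symprod_congr.
move: (symprod _ _) (symprod _ _) (symprod _ _) => A B C.
by rewrite mulmxDr mulmxBr mulmxDl mulmxBl -scalemxAr -scalemxAl.
Qed.

End Isomorphism.

Lemma orbit_commutative c d : (forall x y, product d x y = product d y x) ->
  Defs.orbit c d -> forall x y, product c x y = product c y x.
Proof.
move=> comm_d /orbitP[P PU iso] x y.
by rewrite -(mulKVmx PU x) -(mulKVmx PU y) -!iso comm_d.
Qed.

Lemma closure_traceless c d : (forall x, \tr (lmul c x) = 0) ->
  orbit_closure c d -> forall x, \tr (lmul d x) = 0.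
Proof.
move=> c0 cl x; apply: (closure_vanish (polynomial_trace x) _ cl) => c'.
by move=> /orbitP[P PU iso]; rewrite (iso_trace PU iso).
Qed.

Lemma closure_trace_square c d :
  (forall x, 3 * \tr (lmul c x *m lmul c x) = \tr (lmul c x) ^+ 2) ->
  orbit_closure c d ->
  forall x, 3 * \tr (lmul d x *m lmul d x) = \tr (lmul d x) ^+ 2.
Proof.
move=> c0 cl x; apply/eqP; rewrite -subr_eq0; apply/eqP.
pose f c := 3 * \tr (lmul c x *m lmul c x) - \tr (lmul c x) ^+ 2.
apply: (@closure_vanish _ f c d _ _ cl) => [|c' /orbitP[P PU iso]].
  apply: polynomialD; last first.
    by apply/polynomialN/polynomialM; exact: polynomial_trace.
  apply: polynomialM; first exact: polynomial_const.
  apply: polynomial_sum => i.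
  apply: (@polynomial_ext _ (fun c => \sum_j lmul c x i j * lmul c x j i)).
    by move=> ?; rewrite [RHS]mxE.
  by apply: polynomial_sum => j; apply: polynomialM; exact: polynomial_lmul.
by rewrite /f (iso_trace_square PU iso) (iso_trace PU iso) c0 subrr.
Qed.

Lemma polynomial_jordan_part x y k :
  polynomial_in (fun c => jordan_part c x y k 0).
Proof.
apply: (@polynomial_ext _ (fun c => 3 * (product c x y k 0 + product c y x k 0)
   + - (2 * (\tr (lmul c x) * y k 0 + \tr (lmul c y) * x k 0)))) => [c|].
  rewrite /jordan_part; move: (product c x y) (product c y x) => u v.
  by move: (\tr _) (\tr _) => r s; rewrite !mxE.
have pC := @polynomial_const K; have pP := @polynomial_product K.
have pT := @polynomial_trace K.
by apply: polynomialD; [|apply: polynomialN]; apply: polynomialM => //;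
  apply: polynomialD => //; apply: polynomialM.
Qed.

Lemma polynomial_commutator x y k :
  polynomial_in (fun c => commutator c x y k 0).
Proof.
apply: (@polynomial_ext _ (fun c => product c x y k 0 + - product c y x k 0)).
  move=> c; rewrite /commutator.
  by move: (product c x y) (product c y x) => u v; rewrite !mxE.
by apply: polynomialD; [|apply: polynomialN]; exact: polynomial_product.
Qed.

Lemma polynomial_symprod (F G : structure K -> V) k l :
  (forall i, polynomial_in (fun c => F c i 0)) ->
  (forall i, polynomial_in (fun c => G c i 0)) ->
  polynomial_in (fun c => symprod (F c) (G c) k l).
Proof.
move=> pF pG; apply: (@polynomial_ext _
  (fun c => F c k 0 * G c l 0 + G c k 0 * F c l 0)) => [c|].
  by rewrite symprodE.
by apply: polynomialD; apply: polynomialM.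
Qed.

Lemma pencil_entry (A B C : 'M[K]_3) r k l :
  (A - B + r *: C) k l = A k l - B k l + r * C k l.
Proof. by rewrite !mxE. Qed.

Lemma polynomial_discriminant delta x y k l :
  polynomial_in (fun c => discriminant delta c x y k l).
Proof.
have pJ := polynomial_jordan_part; have pC := polynomial_commutator.
apply: (@polynomial_ext _ (fun c =>
  symprod (jordan_part c x x) (jordan_part c y y) k l
  + - symprod (jordan_part c x y) (jordan_part c x y) k l
  + delta * symprod (commutator c x y) (commutator c x y) k l)) => [c|].
  by rewrite /discriminant pencil_entry.
apply: polynomialD; [apply: polynomialD|].
- exact: polynomial_symprod.
- by apply: polynomialN; exact: polynomial_symprod.
by apply: polynomialM; [exact: polynomial_const | exact: polynomial_symprod].
Qed.

Lemma closure_discriminant delta c d :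
  (forall x y, discriminant delta c x y = 0) ->
  orbit_closure c d -> forall x y, discriminant delta d x y = 0.
Proof.
move=> c0 cl x y; apply/matrixP => k l; rewrite [RHS]mxE.
apply: (closure_vanish (polynomial_discriminant delta x y k l) _ cl) => c'.
move=> /orbitP[P PU iso].
have := c0 (P *m x) (P *m y); rewrite (iso_discriminant PU iso).
have PTU : P^T \in unitmx by rewrite unitmx_tr.
move/(congr1 (fun M => invmx P *m (M *m invmx P^T))).
by rewrite mulmxK // mulKmx // mul0mx mulmx0 => ->; rewrite mxE.
Qed.

Lemma closure_square_zero c d : (forall x, product c x x = 0) ->
  orbit_closure c d -> forall x, product d x x = 0.
Proof.
move=> c0 cl x; apply/colP => k; rewrite [RHS]mxE.
apply: (closure_vanish (polynomial_product x x k) _ cl) => c' /orbitP[P PU iso].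
by rewrite -(mulKmx PU (product c' x x)) iso c0 mulmx0 mxE.
Qed.

End ClosedConditions.

(** * Degenerations *)

(** Checks [det (f1, f2, f3) != 0] by showing that the determinant is [D]. *)
Ltac det_nonzero D :=
  rewrite /=; vectors; rewrite det_frame (_ : _ - _ + _ = D);
  [by do ?[rewrite oppr_eq0 | apply: expf_neq0 | apply: mulf_neq0
           | apply: invr_neq0] | ring].

Ltac morphism x y :=
  coordinates x; coordinates y; vectors;
  rewrite lawsB product_deformation lawsA; tables; apply: eq_vec.

Section Degenerations.
Variable K : numFieldType.
Local Notation e1 := (e K 1).
Local Notation e2 := (e K 2).
Local Notation e3 := (e K 3).

(** In the basis [t e1], [t e2], [t e3] the product is multiplied by [t]. *)
Lemma closure_algA1 c : orbit_closure c (algA K 1).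
Proof.
apply: (@degeneration _ _ _ c (table [::])
  (fun t => t *: e1) (fun t => t *: e2) (fun t => t *: e3)).
- exact: algA_novikov.
- by move=> t t_neq0; det_nonzero (t ^+ 3).
move=> t x y _; rewrite product_deformation.
have tframe (z : 'cV[K]_3) : frame (t *: e1) (t *: e2) (t *: e3) *m z = t *: z.
  by coordinates z; vectors; apply: eq_vec; ring.
rewrite !tframe productZl productZr !product_table !big_nil.
by rewrite add0r scaler0 addr0.
Qed.

(** Up to the term [e3] of [e1 e2], which is negligible against a small multiple
of [e2], the algebra [B_1] is [A_11] with unit [e1]. *)
Lemma algB1_to_A11 : orbit_closure (algB1 K) (algA K 11).
Proof.
apply: (@degeneration _ _ _ (table [:: rule 3 2 e1]) (table [::])
  (fun=> e3) (fun t => t *: e2) (fun=> e1)).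
- exact: algA_novikov.
- by move=> t t_neq0; det_nonzero (- t).
by move=> t x y _; morphism x y; ring.
Qed.

(** The element [f = t e1 + e2] tends to [e2], and [f f - t f = t (e2 + e3)]
becomes its square in the limit. *)
Lemma algB1_to_A5 : orbit_closure (algB1 K) (algA K 5).
Proof.
apply: (@degeneration _ _ _
  (table [:: rule 2 2 e2; rule 2 1 e1; rule 1 2 e1; rule 2 3 e3; rule 3 2 e3])
  (table [:: rule 2 1 e3])
  (fun t => t *: (e2 + e3)) (fun t => t *: e1 + e2) (fun=> e3)).
- exact: algA_novikov.
- by move=> t t_neq0; det_nonzero (- t ^+ 2).
by move=> t x y _; morphism x y; ring.
Qed.

(** As for [B_1]: shrinking [e2] also makes [e2 e2] vanish. *)
Lemma algB2_to_A11 : orbit_closure (algB2 K) (algA K 11).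
Proof.
apply: (@degeneration _ _ _ (table [:: rule 3 2 e1]) (table [:: rule 2 2 e1])
  (fun=> e3) (fun t => t *: e2) (fun=> e1)).
- exact: algA_novikov.
- by move=> t t_neq0; det_nonzero (- t).
by move=> t x y _; morphism x y; ring.
Qed.

(** Here [e2] and [e3] are enlarged with weights 1 and 2, which keeps
[e2 e2 = e3] and kills the term [e3] of [e1 e2]. *)
Lemma algB2_to_A12 : orbit_closure (algB2 K) (algA K 12).
Proof.
apply: (@degeneration _ _ _ (table [:: rule 3 2 e1]) (table [::])
  (fun t => t^-1 ^+ 2 *: e3) (fun t => t^-1 *: e2) (fun=> e1)).
- exact: algA_novikov.
- by move=> t t_neq0; det_nonzero (- t^-1 ^+ 3).
by move=> t x y t_neq0; morphism x y; field.
Qed.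

(** The element [f = t e1 + e2] tends to the nilpotent [e2]. The basis
consists of [f], [f f - t f] and [t e3]; the last is [f (f f)] up to terms that
vanish in the limit. *)
Lemma algB2_to_A10 : orbit_closure (algB2 K) (algA K 10).
Proof.
apply: (@degeneration _ _ _
  (table [:: rule 3 3 e3; rule 2 3 e2; rule 3 2 (e2 + e1); rule 2 2 e1;
             rule 3 1 e1; rule 1 3 e1])
  (table [::])
  (fun t => t *: e3) (fun t => t *: e2 + (t + 1) *: e3)
  (fun t => t *: e1 + e2)).
- exact: algA_novikov.
- by move=> t t_neq0; det_nonzero (- t ^+ 3).
by move=> t x y _; morphism x y; ring.
Qed.

(** As for [A_10], with weights that let the square of [f] disappear: for
[f = t^2 e1 + t e2], the second vector is [(f f - t^2 f) / t]. *)
Lemma algB2_to_A9 : orbit_closure (algB2 K) (algA K 9).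
Proof.
apply: (@degeneration _ _ _
  (table [:: rule 3 3 e2; rule 3 2 e1; rule 2 2 e1])
  (table [:: rule 3 3 e3; rule 2 3 e2; rule 3 2 e2; rule 3 1 e1; rule 1 3 e1])
  (fun t => t ^+ 3 *: e3) (fun t => t ^+ 2 *: e2 + (t ^+ 2 + t) *: e3)
  (fun t => t ^+ 2 *: e1 + t *: e2)).
- exact: algA_novikov.
- by move=> t t_neq0; det_nonzero (- t ^+ 7).
by move=> t x y _; morphism x y; ring.
Qed.

(** The basis used for [A_10], but with [e3] in place of [t e3]: now [f (f f)]
disappears and only the square of [f] is left. *)
Lemma algB2_to_A5 : orbit_closure (algB2 K) (algA K 5).
Proof.
apply: (@degeneration _ _ _
  (table [:: rule 2 2 e2; rule 1 2 (e1 + e3); rule 2 1 (e1 + e3); rule 2 3 e3;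
             rule 3 2 e3])
  (table [:: rule 2 1 e3; rule 1 1 e3])
  (fun t => t *: e2 + (t + 1) *: e3) (fun t => t *: e1 + e2) (fun=> e3)).
- exact: algA_novikov.
- by move=> t t_neq0; det_nonzero (- t ^+ 2).
by move=> t x y _; morphism x y; ring.
Qed.

Lemma algB3_to_A5 : orbit_closure (algB3 K) (algA K 5).
Proof.
apply: (@degeneration _ _ _
  (table [:: rule 3 2 (2^-1 *: e1); rule 2 3 (- 2^-1 *: e1)]) (table [::])
  (fun=> e3) (fun=> e2) (fun t => t *: e1)).
- exact: algA_novikov.
- by move=> t t_neq0; det_nonzero (- t).
by move=> t x y _; morphism x y; ring.
Qed.

Lemma algB4_to_A5 alpha : orbit_closure (algB4 (alpha : K)) (algA K 5).
Proof.
apply: (@degeneration _ _ _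
  (table [:: rule 1 2 (alpha *: e3); rule 2 1 ((alpha - 1) *: e3)]) (table [::])
  (fun t => t ^+ 2 *: e1) (fun t => t *: e2) (fun t => t ^+ 2 *: e3)).
- exact: algA_novikov.
- by move=> t t_neq0; det_nonzero (t ^+ 5).
by move=> t x y _; morphism x y; ring.
Qed.

(** The element [e1 + e2] has the nonzero square [(2 beta - 1) e3]. *)
Lemma algB5_to_A5 (beta : K) :
  beta != 2^-1 -> orbit_closure (algB5 beta) (algA K 5).
Proof.
move=> beta2; have gap_neq0 : 2 * beta - 1 != 0.
  apply: contraNneq beta2 => /eqP; rewrite subr_eq0 => /eqP double_beta.
  by rewrite -(mulKf (_ : 2 != 0) beta) ?pnatr_eq0 // double_beta mulr1.
apply: (@degeneration _ _ _
  (table [:: rule 3 2 (beta *: e1); rule 2 3 ((beta - 1) *: e1)]) (table [::])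
  (fun t => (2 * beta - 1) *: e3) (fun=> e1 + e2)
  (fun t => ((2 * beta - 1) * t) *: e1)).
- exact: algA_novikov.
- by move=> t t_neq0; det_nonzero (- (2 * beta - 1) ^+ 2 * t).
by move=> t x y _; morphism x y; ring.
Qed.

End Degenerations.

(** * The closed conditions in the algebras *)

Lemma natr_gap (K : numDomainType) (n : nat) (a b : K) :
  a = b -> a - b = n.+1%:R -> False.
Proof. by move=> ->; rewrite subrr => /esym/eqP; rewrite pnatr_eq0. Qed.

(** Refutes an equation [H] between numbers that differ by [n + 1]. *)
Ltac gap n H := case: (natr_gap (n := n) H); ring.

Ltac traces :=
  rewrite !trace_ecoord -?mulmxA !mul_lmul; vectors;
  rewrite ?(lawsA, lawsB) !ecoord_vec.

Ltac discriminant_entry :=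
  rewrite /discriminant /jordan_part /commutator; traces; rewrite ?lawsA;
  vectors; rewrite pencil_entry !symprodE !mxE /=.

Ltac discriminant0 k l :=
  rewrite [RHS]mxE; discriminant_entry;
  elim/ord3_ind: k; elim/ord3_ind: l => /=; ring.

Section Boundaries.
Variable K : numFieldType.
Implicit Types (c : structure K) (x y : 'cV[K]_3).

(** Outside the list, [e3] or (for [A_7]) [e2] is an idempotent of nonzero
trace. *)
Lemma traceless_algA j : (1 <= j <= 12)%N ->
  (forall x, \tr (lmul (algA K j) x) = 0) -> j \in [:: 1; 5; 9; 10]%N.
Proof.
move=> hj tr0; have := tr0 (vec 0 0 1); have := tr0 (vec 0 1 0).
do 13?[case: j hj tr0 => [|j] hj tr0] => //; traces => tr2 tr3;
  solve [gap 0%N tr3 | gap 2%N tr3 | gap 1%N tr2].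
Qed.

(** Outside the list, [e3] acts as a projection of rank 1, or (in [A_7]) [e2]
acts as one of rank 2. *)
Lemma trace_square_algA j : (1 <= j <= 12)%N ->
  (forall x, 3 * \tr (lmul (algA K j) x *m lmul (algA K j) x)
     = \tr (lmul (algA K j) x) ^+ 2) -> j \in [:: 1; 5; 9; 10; 11; 12]%N.
Proof.
move=> hj tr0; have := tr0 (vec 0 0 1); have := tr0 (vec 0 1 0).
do 13?[case: j hj tr0 => [|j] hj tr0] => //; traces => tr2 tr3;
  solve [gap 1%N tr3 | gap 1%N tr2].
Qed.

Lemma square_zero_algA j : (1 <= j <= 12)%N ->
  (forall x, product (algA K j) x x = 0) -> j = 1%N.
Proof.
move=> hj sq0; have := sq0 (vec 0 1 1).
do 13?[case: j hj sq0 => [|j] hj sq0] => //;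
  rewrite lawsA vec0 => /vec_inj[a b c];
  solve [gap 0%N c | gap 0%N b | gap 0%N a | gap 1%N a].
Qed.

(** The commutator vanishes in [A_j], so the condition says that
[N(x, x) N(y, y)] is the square of [N(x, y)], whatever [delta] is. At [x = e2],
[y = e3], the vectors [N(x, x)], [N(y, y)], [N(x, y)] are [0], [0], [6 e1] in
[A_9]; [0], [6 e2], [6 e1] in [A_10]; and [6 e1], [- 6 e3], [0] in [A_12]. *)
Lemma disc_algA delta j :
  (forall x y, discriminant delta (algA K j) x y = 0) ->
  j \notin [:: 9; 10; 12]%N.
Proof.
move=> disc0; have := disc0 (vec 0 1 0) (vec 0 0 1).
rewrite !inE; apply: contraPN; case/or3P => /eqP -> /matrixP.
- move/(_ o1 o1); discriminant_entry => /esym H; gap 71%N H.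
- move/(_ o1 o1); discriminant_entry => /esym H; gap 71%N H.
- move/(_ o1 o3); discriminant_entry => /esym H; gap 35%N H.
Qed.

(** Here [N(x, y) = - 6 x1 y1 e1 + 3 (x1 y2 + x2 y1) e3] and
[[x, y] = (x1 y2 - x2 y1) e3]; only the square of [e3] has a nonzero coefficient
in [N(x, x) N(y, y) - N(x, y)^2], namely [- 9 (x1 y2 - x2 y1)^2]. *)
Lemma algB1_disc x y : discriminant 9 (algB1 K) x y = 0.
Proof.
by coordinates x; coordinates y; apply/matrixP => k l; discriminant0 k l.
Qed.

(** Here [N(x, y) = 6 x2 y2 e3] has rank one. *)
Lemma algB3_disc x y : discriminant 0 (algB3 K) x y = 0.
Proof.
by coordinates x; coordinates y; apply/matrixP => k l; discriminant0 k l.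
Qed.

(** The constant is forced by [B_5(alpha)], a degeneration of [B_4(alpha)]:
there the symmetric part is [(alpha - 1/2) (x1 y2 + x2 y1) e3] and the
commutator is [(x1 y2 - x2 y1) e3]. *)
Lemma algB4_disc (alpha : K) x y :
  discriminant ((3 * (2 * alpha - 1)) ^+ 2) (algB4 alpha) x y = 0.
Proof.
by coordinates x; coordinates y; apply/matrixP => k l; discriminant0 k l.
Qed.

Lemma algB5_disc (beta : K) x y :
  discriminant ((3 * (2 * beta - 1)) ^+ 2) (algB5 beta) x y = 0.
Proof.
by coordinates x; coordinates y; apply/matrixP => k l; discriminant0 k l.
Qed.

Lemma algB1_trace_square x :
  3 * \tr (lmul (algB1 K) x *m lmul (algB1 K) x) = \tr (lmul (algB1 K) x) ^+ 2.
Proof. by coordinates x; traces; ring. Qed.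

Lemma algB2_trace_square x :
  3 * \tr (lmul (algB2 K) x *m lmul (algB2 K) x) = \tr (lmul (algB2 K) x) ^+ 2.
Proof. by coordinates x; traces; ring. Qed.

Lemma algB3_traceless x : \tr (lmul (algB3 K) x) = 0.
Proof. by coordinates x; traces; ring. Qed.

Lemma algB4_traceless alpha x : \tr (lmul (algB4 (alpha : K)) x) = 0.
Proof. by coordinates x; traces; ring. Qed.

Lemma algB5_traceless alpha x : \tr (lmul (algB5 (alpha : K)) x) = 0.
Proof. by coordinates x; traces; ring. Qed.

Lemma algB5_square x : product (algB5 (2^-1 : K)) x x = 0.
Proof. by coordinates x; rewrite lawsB vec0; apply: eq_vec => //; field. Qed.

(** * The boundaries of the orbits *)

Ltac noncommutative :=
  rewrite /commutator; vectors; rewrite !lawsB; vectors;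
  apply: eq_vec; by field.

(** The orbit itself contains no [A_j]: these are commutative, while
[e1 e2 - e2 e1 = e3] in each of the algebras [B]. *)
Lemma boundary_algA c j : (1 <= j <= 12)%N ->
  commutator c (e K 1) (e K 2) = e K 3 ->
  boundary c (algA K j) <-> orbit_closure c (algA K j).
Proof.
move=> /andP[_ j12] nc; split=> [[]// | clAj]; split=> // orbAj.
have /esym := nc; rewrite /commutator.
rewrite (orbit_commutative _ orbAj (e K 1) (e K 2)) => [|x y]; last first.
  exact: algA_commutative.
rewrite subrr e3E vec0 => /vec_inj[_ _] H; gap 0%N H.
Qed.

Lemma boundary_algB1 j : (1 <= j <= 12)%N ->
  boundary (algB1 K) (algA K j) <-> j \in [:: 1; 5; 11]%N.
Proof.
move=> hj; rewrite boundary_algA //; last by noncommutative.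
split=> [cl | ].
  have := disc_algA (closure_discriminant algB1_disc cl).
  have := trace_square_algA hj (closure_trace_square algB1_trace_square cl).
  by rewrite !inE => /or4P[||| /or3P[]] /eqP ->.
rewrite !inE => /or3P[] /eqP ->.
- exact: closure_algA1.
- exact: algB1_to_A5.
- exact: algB1_to_A11.
Qed.

Lemma boundary_algB2 j : (1 <= j <= 12)%N ->
  boundary (algB2 K) (algA K j) <-> j \in [:: 1; 5; 9; 10; 11; 12]%N.
Proof.
move=> hj; rewrite boundary_algA //; last by noncommutative.
split=> [cl | ].
  exact: trace_square_algA hj (closure_trace_square algB2_trace_square cl).
rewrite !inE => /or4P[||| /or3P[]] /eqP ->.
- exact: closure_algA1.
- exact: algB2_to_A5.
- exact: algB2_to_A9.
- exact: algB2_to_A10.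
- exact: algB2_to_A11.
- exact: algB2_to_A12.
Qed.

Lemma nilpotent_closure c delta j : (1 <= j <= 12)%N ->
  (forall x, \tr (lmul c x) = 0) ->
  (forall x y, discriminant delta c x y = 0) ->
  orbit_closure c (algA K j) -> j \in [:: 1; 5]%N.
Proof.
move=> hj tr0 disc0 cl.
have := disc_algA (closure_discriminant disc0 cl).
have := traceless_algA hj (closure_traceless tr0 cl).
by rewrite !inE => /or4P[] /eqP ->.
Qed.

Lemma boundary_algB3 j : (1 <= j <= 12)%N ->
  boundary (algB3 K) (algA K j) <-> j \in [:: 1; 5]%N.
Proof.
move=> hj; rewrite boundary_algA //; last by noncommutative.
split=> [|]; first exact: nilpotent_closure hj algB3_traceless algB3_disc.
rewrite !inE => /orP[] /eqP ->; [exact: closure_algA1 | exact: algB3_to_A5].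
Qed.

Lemma boundary_algB4 (alpha : K) j : (1 <= j <= 12)%N ->
  boundary (algB4 alpha) (algA K j) <-> j \in [:: 1; 5]%N.
Proof.
move=> hj; rewrite boundary_algA //; last by noncommutative.
split=> [|].
  exact: nilpotent_closure hj (algB4_traceless alpha) (algB4_disc alpha).
rewrite !inE => /orP[] /eqP ->; [exact: closure_algA1 | exact: algB4_to_A5].
Qed.

Lemma boundary_algB5 (beta : K) j : beta != 2^-1 -> (1 <= j <= 12)%N ->
  boundary (algB5 beta) (algA K j) <-> j \in [:: 1; 5]%N.
Proof.
move=> beta2 hj; rewrite boundary_algA //; last by noncommutative.
split=> [|].
  exact: nilpotent_closure hj (algB5_traceless beta) (algB5_disc beta).
rewrite !inE => /orP[] /eqP ->; [exact: closure_algA1 | exact: algB5_to_A5].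
Qed.

Lemma boundary_algB5_half j : (1 <= j <= 12)%N ->
  boundary (algB5 (2^-1 : K)) (algA K j) <-> j \in [:: 1]%N.
Proof.
move=> hj; rewrite boundary_algA //; last by noncommutative.
rewrite inE; split=> [cl | /eqP ->]; last exact: closure_algA1.
by apply/eqP/(square_zero_algA hj)/(closure_square_zero algB5_square cl).
Qed.

End Boundaries.

Theorem proposition4p7 (R : realType) (j : nat) (hj : (1 <= j <= 12)%N) :
  (boundary (algB1 R[i]) (algA R[i] j) <-> j \in [:: 1; 5; 11]%N) /\
  (boundary (algB2 R[i]) (algA R[i] j) <-> j \in [:: 1; 5; 9; 10; 11; 12]%N) /\
  (boundary (algB3 R[i]) (algA R[i] j) <-> j \in [:: 1; 5]%N) /\
  (forall alpha : R[i],
     boundary (algB4 alpha) (algA R[i] j) <-> j \in [:: 1; 5]%N) /\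
  (forall beta : R[i], beta <> 2^-1 ->
     (boundary (algB5 beta) (algA R[i] j) <-> j \in [:: 1; 5]%N)) /\
  (boundary (algB5 (2^-1 : R[i])) (algA R[i] j) <-> j \in [:: 1]%N).
Proof.
split; first exact: (@boundary_algB1 R[i]).
split; first exact: (@boundary_algB2 R[i]).
split; first exact: (@boundary_algB3 R[i]).
split=> [alpha|]; first exact: (@boundary_algB4 R[i]).
split=> [beta /eqP beta_neq|]; first exact: (@boundary_algB5 R[i]).
exact: (@boundary_algB5_half R[i]).
Qed.
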